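(* Let $A\in\mathbb{R}^{n\times n}$, $T>0$, and $i\in\{1,\dots,n\}$. Assume that there exists $\ell_i\in\mathbb{R}$ such that $e_i^\top A=\ell_i\,e_i^\top$. Suppose that $p\in X_T$. Then $$g_T(p)\ \ge\ \frac{1}{p_i\,\omega_i(T)},$$ where $$\omega_i(T)=\begin{cases}T & \text{if } \ell_i=0,\\[1mm] \dfrac{e^{2\ell_iT}-1}{2\ell_i} & \text{if } \ell_i\neq 0.\end{cases}$$
   Context: $e_i$ is the $i$th standard basis vector of $\mathbb{R}^n$; $X\succ O$ means symmetric positive definite. For $T>0$ and $p\in\mathbb{R}^n$, the finite-time controllability Gramian is $$W(p,T):=\sum_{j=1}^n p_jW_j(T),\qquad W_j(T):=\int_0^T \exp(At)\,e_je_j^\top\exp(A^\top t)\,\mathrm{d}t.$$ When $p$ has nonnegative entries, with $B(p):=\mathrm{diag}(\sqrt{p_1},\ldots,\sqrt{p_n})$, this equals $\int_0^T\exp(At)B(p)B(p)^\top\exp(A^\top t)\,\mathrm{d}t$. $X_T:=\{p\in\mathbb{R}^n\mid W(p,T)\succ O\}$, and for $p\in X_T$, $g_T(p):=\mathrm{tr}\left(W(p,T)^{-1}\right)$. *)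

(* Defs.v *)
From HB Require Import structures.
From mathcomp Require Import all_boot all_order all_algebra.
From mathcomp Require Import all_classical all_reals all_analysis.

Set Implicit Arguments.
Unset Strict Implicit.
Unset Printing Implicit Defensive.
Import Order.TTheory GRing.Theory Num.Theory.
Import numFieldNormedType.Exports.
Local Open Scope classical_set_scope.
Local Open Scope ring_scope.

Section Defs.
Context {R : realType} {n : nat}.
Implicit Types (A M X : 'M[R]_n) (T t l : R) (p : 'cV[R]_n) (j : 'I_n).

(* The limit is taken in the normed space of matrices, where the exponential
   series always converges. *)
Definition expmx M : 'M[R]_n :=
  limn (series (fun k => (k`!%:R)^-1 *: M ^+ k)).

Definition stdbasis j : 'cV[R]_n := delta_mx j ord0.

Definition posdefmx X : Prop :=
  X^T = X /\ forall x : 'cV[R]_n, x != 0 -> 0 < (x^T *m X *m x) ord0 ord0.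

(* The integral of a matrix-valued function is taken entrywise. *)
Definition gramian1 A T j : 'M[R]_n :=
  \matrix_(a, b) \int[lebesgue_measure]_(t in `[0, T])
    (expmx (t *: A) *m stdbasis j *m (stdbasis j)^T *m expmx (t *: A^T)) a b.

Definition gramian A p T : 'M[R]_n :=
  \sum_(j < n) p j ord0 *: gramian1 A T j.

Definition ctrl_domain A T : set 'cV[R]_n :=
  [set p | posdefmx (gramian A p T)].

(* [invmx] is the genuine inverse only on invertible matrices; this is the
   intended function for [p] in [ctrl_domain A T]. *)
Definition ctrl_trace A T p : R := \tr (invmx (gramian A p T)).

End Defs.

Definition omega {R : realType} (l T : R) : R :=
  if l == 0 then T else (expR (2 * l * T) - 1) / (2 * l).

(* Main.v *)
(* Since e_i is a left eigenvector of A, the i-th row of exp(At) is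
   e^(l t) e_i^T, so only the j = i summand contributes to the (i, i) entry of
   the Gramian W, and W_ii = p_i omega_i(T). The diagonal of W^-1 is positive
   and (W^-1)_ii >= 1 / W_ii by positive definiteness, so
   tr(W^-1) >= (W^-1)_ii >= 1 / W_ii. *)
From HB Require Import structures.
Require Import Defs.
From mathcomp Require Import all_boot all_order all_algebra.
From mathcomp Require Import all_classical all_reals all_analysis.
Set Implicit Arguments.
Unset Strict Implicit.
Unset Printing Implicit Defensive.
Import Order.TTheory GRing.Theory Num.Theory.
Import numFieldNormedType.Exports.
Local Open Scope classical_set_scope.
Local Open Scope ring_scope.

(* Joins the existing completeness and norm structures on matrices, so that
   absolutely convergent matrix series converge. *)
HB.instance Definition _ (R : realType) (m n : nat) :=
  Uniform_isComplete.Build 'M[R]_(m, n) cauchy_cvg.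

Lemma ler_entry_mx_norm (R : realType) m n (M : 'M[R]_(m, n)) a b :
  `|M a b| <= `|M|.
Proof.
rewrite [leRHS]/Num.Def.normr /= mx_normrE.
exact: (le_bigmax _ (fun ij : 'I_m * 'I_n => `|M ij.1 ij.2|) (a, b)).
Qed.

(** The norm is the largest absolute entry, which is not submultiplicative. Each entry of the
    product sums [n] terms, whence the factor [n%:R]. *)
Lemma ler_mx_normM (R : realType) m n q (M : 'M[R]_(m, n)) (N : 'M[R]_(n, q)) :
  `|M *m N| <= n%:R * (`|M| * `|N|).
Proof.
rewrite [leLHS]/Num.Def.normr /= mx_normrE; apply/bigmax_leP; split=> [|[a b] _ /=].
  by rewrite !mulr_ge0.
rewrite mxE (le_trans (ler_norm_sum _ _ _))// mulr_natl.
have -> : `|M| * `|N| *+ n = \sum_(j < n) `|M| * `|N|.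
  by rewrite sumr_const card_ord.
by apply: ler_sum => j _; rewrite normrM ler_pM// ler_entry_mx_norm.
Qed.

Lemma ler_mx_normX (R : realType) n (M : 'M[R]_n) k :
  `|M ^+ k| <= (n%:R * `|M|) ^+ k * `|1 : 'M[R]_n|.
Proof.
elim: k => [|k IH]; first by rewrite !expr0 mul1r.
rewrite exprS (le_trans (ler_mx_normM _ _))//.
by rewrite exprS -!mulrA !ler_wpM2l.
Qed.

Section expmx.
Context {R : realType} {n : nat}.
Implicit Types (M : 'M[R]_n) (l : R) (u : 'rV[R]_n).

Local Notation partial_expmx M :=
  (series (fun k => (k`!%:R)^-1 *: M ^+ k : 'M[R]_n)).

(** Absolute convergence by comparison with the scalar exponential series at [n%:R * |M|], rescaled
    by the norm of the identity; completeness then gives convergence. *)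
Lemma cvg_partial_expmx M : partial_expmx M @ \oo --> expmx M.
Proof.
pose v := `|1 : 'M[R]_n| *: (exp_coeff (n%:R * `|M|) : nat -> R^o).
have vE k : v k = `|1 : 'M[R]_n| * ((n%:R * `|M|) ^+ k / k`!%:R) by [].
have cv : cvgn (series v).
  by apply: is_cvg_seriesZ; exact: is_cvg_series_exp_coeff.
apply: normed_cvg; apply: (series_le_cvg _ _ _ cv) => k.
- exact: normr_ge0.
- by rewrite vE mulr_ge0// divr_ge0// exprn_ge0// mulr_ge0.
- rewrite vE /= normrZ ger0_norm ?invr_ge0// mulrA [leRHS]mulrC.
  by rewrite ler_wpM2l ?invr_ge0// mulrC ler_mx_normX.
Qed.

Lemma cvg_partial_expmx_entry M a b :
  partial_expmx M N a b @[N --> \oo] --> expmx M a b.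
Proof.
have /continuous_cvg := @coord_continuous R n n a b (expmx M).
by move/(_ _ _ _ _ (@cvg_partial_expmx M)).
Qed.

(** Transposition commutes with every partial sum, and entrywise limits are unique. *)
Lemma expmx_tr M : expmx M^T = (expmx M)^T.
Proof.
apply/matrixP => a b; rewrite mxE.
have trX k : M^T ^+ k = (M ^+ k)^T.
  elim: k => [|k IH]; first by rewrite !expr0 trmx1.
  by rewrite exprSr exprS IH; exact/esym/trmx_mul.
have trS : (fun N => partial_expmx M^T N a b) = (fun N => partial_expmx M N b a).
  apply/funext => N; rewrite /series /= !summxE; apply: eq_bigr => k _.
  by rewrite trX !mxE.
have cvT := @cvg_partial_expmx_entry M^T a b; rewrite trS in cvT.
exact: cvg_unique cvT (@cvg_partial_expmx_entry M b a).
Qed.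

(** By induction [u *m M ^+ k = l ^+ k *: u], so on [u] the matrix partial sums act as those of the
    scalar exponential series; the limit is taken entry by entry. *)
Lemma mulmx_expmx_eigen M l u :
  u *m M = l *: u -> u *m expmx M = expR l *: u.
Proof.
move=> uM; apply/rowP => b; rewrite !mxE.
have uS N : u *m partial_expmx M N = series (exp_coeff l) N *: u.
  rewrite /series /= mulmx_sumr scaler_suml; apply: eq_bigr => k _.
  rewrite -scalemxAr /exp_coeff /= mulrC -scalerA; congr (_ *: _).
  elim: k => [|k IH]; first by rewrite !expr0 mulmx1 scale1r.
  by rewrite exprSr mulmxA IH -scalemxAl uM scalerA -exprSr.
have lhs : \sum_a u ord0 a * partial_expmx M N a b @[N --> \oo]
    --> \sum_a u ord0 a * expmx M a b.
  apply: cvg_big => [|a _]; first exact: add_continuous.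
  by apply: cvgMl_tmp; exact: cvg_partial_expmx_entry.
have uSE : (fun N => \sum_a u ord0 a * partial_expmx M N a b) =
           (fun N => series (exp_coeff l) N * u ord0 b).
  by apply/funext => N; have /rowP/(_ b) := uS N; rewrite !mxE.
rewrite uSE in lhs; apply: cvg_unique lhs _ => //.
by apply: cvgMr_tmp; exact: is_cvg_series_exp_coeff.
Qed.

End expmx.

Lemma Rintegral_expR_sqr (R : realType) (l T : R) : 0 < T ->
  \int[lebesgue_measure]_(t in `[0, T]) (expR (t * l)) ^+ 2 = omega l T.
Proof.
move=> T0; rewrite /omega; case: eqP => [->|/eqP l0].
  under eq_Rintegral do rewrite mulr0 expR0 expr1n.
  rewrite Rintegral_cst//= lebesgue_measure_itv/= lte_fin T0/= mul1r.
  by rewrite subr0.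
(* An antiderivative of the integrand, available since [l != 0]; [F T - F 0] is the second branch of
   [omega]. *)
pose F (t : R) := expR (2 * l * t) / (2 * l).
have dF (t : R) : is_derive t 1 F (expR (t * l) ^+ 2).
  have -> : F = (2 * l)^-1 \*: (expR \o ( *%R (2 * l))).
    by apply/funext => x; rewrite /F /= mulrC.
  apply: is_derive_eq.
  by rewrite -expRM_natl /GRing.scale /= mulr1 mulrCA mulVf ?mulf_neq0//
    mulr1 mulrA mulrAC.
have cF : continuous F.
  by move=> t; exact/differentiable_continuous/derivable1_diffP.
have cf : continuous (fun t : R => expR (t * l) ^+ 2).
  move=> t; apply/differentiable_continuous/derivable1_diffP.
  exact: ex_derive.
rewrite /Rintegral (@continuous_FTC2 _ _ F)//=.
- by rewrite /F mulr0 expR0 mulrBl.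
- exact: continuous_subspaceT.
- split=> [t _||]; first exact: ex_derive.
  + exact/cvg_at_right_filter/cF.
  + exact/cvg_at_left_filter/cF.
- by move=> t _; rewrite derive1E derive_val.
Qed.

Section posdef.
Context {R : realType} {n : nat}.
Implicit Types W : 'M[R]_n.

Lemma posdefmx_unit W : posdefmx W -> W \in unitmx.
Proof.
(* [kermx] is a left kernel. Passing to the transpose turns a nonzero [v] in it into [W *m v^T = 0],
   against positivity at [v^T]. *)
move=> [_ Wpos]; rewrite -unitmx_tr -row_free_unit -kermx_eq0.
apply/negPn/negP => /rowV0Pn[v /sub_kermxP vW v0].
have := Wpos v^T; rewrite trmxK -mulmxA.
have -> : W *m v^T = 0 by rewrite -[W]trmxK -trmx_mul vW trmx0.
by rewrite mulmx0 mxE ltxx trmx_eq0 => /(_ v0).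
Qed.

(** The zero vector has to be allowed: the test vector used below for the diagonal of the inverse
    vanishes when [W] is diagonal. *)
Lemma posdefmx_ge0 W (x : 'cV[R]_n) :
  posdefmx W -> 0 <= (x^T *m W *m x) ord0 ord0.
Proof.
move=> [_ Wpos]; have [->|x0] := eqVneq x 0; last exact/ltW/Wpos.
by rewrite mulmx0 mxE.
Qed.

Lemma stdbasis_form W (j k : 'I_n) :
  ((stdbasis j)^T *m W *m stdbasis k) ord0 ord0 = W j k.
Proof. by rewrite trmx_delta -rowE -colE !mxE. Qed.

Lemma posdefmx_inv_tr W : posdefmx W -> (invmx W)^T = invmx W.
Proof. by move=> [Wsym _]; rewrite trmx_inv Wsym. Qed.

Lemma posdefmx_diag_gt0 W j : posdefmx W -> 0 < W j j.
Proof.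
move=> [_ Wpos]; rewrite -stdbasis_form; apply: Wpos.
apply/eqP => /matrixP/(_ j ord0)/eqP.
by rewrite !mxE !eqxx oner_eq0.
Qed.

(* The quadratic form of W is nonnegative at (W^-1 - (W j j)^-1) e_j. *)
Lemma posdefmx_inv_diag_ge W j : posdefmx W -> (W j j)^-1 <= invmx W j j.
Proof.
move=> Wpos; have Wu := posdefmx_unit Wpos; have Wj := posdefmx_diag_gt0 j Wpos.
set c := (W j j)^-1.
pose x := (invmx W - c%:M) *m stdbasis j.
have := posdefmx_ge0 x Wpos.
have -> : x^T *m W *m x =
    (stdbasis j)^T *m (invmx W - c%:M - c%:M + (c * c) *: W) *m stdbasis j.
  rewrite /x trmx_mul linearB /= posdefmx_inv_tr// tr_scalar_mx !mulmxA.
  congr (_ *m _); rewrite -!mulmxA; congr (_ *m _).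
  rewrite mulmxA mulmxBl mulVmx// mul_scalar_mx mulmxBr mulmxBl mul1mx.
  rewrite !mul_mx_scalar -scalemxAl mulmxV// scalemx1 scalerBr.
  by rewrite scalemx1 scalerA opprB addrA addrAC.
(* The form is now the (j, j) entry of [invmx W] minus [2 * c] plus [c * c * W j j]. As [c] is the
   inverse of [W j j], the last term equals [c] and cancels one of the two subtracted copies. *)
rewrite stdbasis_form !mxE eqxx /= /c mulr1n -mulrA mulVf ?gt_eqF// mulr1.
by rewrite subrK subr_ge0.
Qed.

Lemma posdefmx_inv_diag_ge0 W j : posdefmx W -> 0 <= invmx W j j.
Proof.
move=> Wpos; apply: le_trans (posdefmx_inv_diag_ge j Wpos).
by rewrite invr_ge0 ltW// posdefmx_diag_gt0.
Qed.

End posdef.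

Lemma gramian_diag_eigen (R : realType) n (A : 'M[R]_n) (T : R) (p : 'cV[R]_n)
    (i : 'I_n) (l : R) :
  0 < T -> (stdbasis i)^T *m A = l *: (stdbasis i)^T :> 'rV[R]_n ->
  gramian A p T i i = p i ord0 * omega l T.
Proof.
move=> T0 Ai; rewrite /gramian summxE.
have expA t j : expmx (t *: A) i j = expR (t * l) * (i == j)%:R.
  have /mulmx_expmx_eigen/rowP/(_ j) : (stdbasis i)^T *m (t *: A) =
      (t * l) *: (stdbasis i)^T :> 'rV[R]_n.
    by rewrite -scalemxAr Ai scalerA.
  by rewrite trmx_delta -rowE !mxE eqxx /= eq_sym.
(* With [v] the [j]-th column of exp(tA), the integrand is the rank-one matrix [v *m v^T], so its
   diagonal entries are squares. *)
have entry t j : (expmx (t *: A) *m stdbasis j *m (stdbasis j)^T *m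
    expmx (t *: A^T)) i i = expmx (t *: A) i j ^+ 2.
  rewrite -linearZ /= expmx_tr -!mulmxA -trmx_mul mulmxA -colE.
  by rewrite mxE big_ord1 !mxE expr2.
rewrite (bigD1 i)//= big1 ?addr0 => [|j ji]; rewrite !mxE.
  under eq_Rintegral do rewrite entry expA eqxx mulr1.
  by rewrite Rintegral_expR_sqr.
under eq_Rintegral do rewrite entry expA eq_sym (negbTE ji) mulr0 expr0n.
by rewrite Rintegral_cst//= mul0r mulr0.
Qed.

Theorem theorem1 (R : realType) (n : nat) (A : 'M[R]_n) (T : R) (hT : 0 < T)
    (i : 'I_n) (l : R)
    (hl : (stdbasis i)^T *m A = l *: (stdbasis i)^T :> 'rV[R]_n)
    (p : 'cV[R]_n) (hp : ctrl_domain A T p) :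
  1 / (p i ord0 * omega l T) <= ctrl_trace A T p.
Proof.
(* The denominator becomes the (i, i) entry of the Gramian, and the trace is split at [i]. *)
rewrite div1r -(gramian_diag_eigen p hT hl) /ctrl_trace /mxtrace (bigD1 i)//=.
apply: (le_trans (posdefmx_inv_diag_ge i hp)).
by rewrite lerDl sumr_ge0// => j _; exact: posdefmx_inv_diag_ge0.
Qed.
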